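(* Let $f:\mathbb{R}^d\to\mathbb{R}$ be twice differentiable with $L$-Lipschitz continuous Hessian ($L>0$), i.e. $\|\nabla^2 f(x)-\nabla^2 f(x')\|\le L\|x-x'\|$ for all $x,x'\in\mathbb{R}^d$, possibly nonconvex, and with $f^*:=\inf_{x\in\mathbb{R}^d} f(x)>-\infty$. Let $x_0\in\mathbb{R}^d$, $F_0:=f(x_0)-f^*$, $\epsilon>0$, and let $m\ge 1$ be an integer. Then running the algorithm NALEN$(f,x_0,N)$ (described in the context, with Hessian-update period $m$) with parameters $$\eta=\Theta\Big(\frac{1}{mLD}\Big),\qquad T=\Theta(m^{1/3}),\qquad D=\Theta\Big(\Big(\frac{F_0}{N L m^{2/3}}\Big)^{1/3}\Big)$$ finds an $\epsilon$-stationary point, i.e. a point $\hat y$ with $\|\nabla f(\hat y)\|\le\epsilon$, in $$N=\mathcal{O}\big(m+m^{1/3}F_0L^{1/2}\epsilon^{-3/2}\big)$$ iterations. In particular, choosing $m=\Theta(\bar d)$, where $\bar d$ is the effective dimension, to minimize the total oracle cost, the equivalent gradient complexity of the algorithm is $\mathcal{O}\big(\bar d+\bar d^{1/3}F_0L^{1/2}\epsilon^{-3/2}\big)$.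
   Context: Norms are Euclidean (vectors) and spectral (matrices). $\mathbb{B}_D^d(0)=\{x\in\mathbb{R}^d:\|x\|\le D\}$. For an integer $m\ge1$, $\pi(n)=n-(n \bmod m)$. Asymptotic notation: $\mathcal{O}$ and $\Theta$ hide only universal numerical constants. ''Running with parameter $=\Theta(E)$'' means that the parameter is set to a suitably chosen universal constant times $E$ (rounded to a positive integer for integer parameters). Algorithm NALEN$(f,x_0,N)$, with parameters $T\in\mathbb{N}_+$, $\eta,D>0$ and period $m$: Set $v_0=\Delta_0=-D\nabla f(x_0)/\|\nabla f(x_0)\|$ and $K=\lfloor N/T\rfloor$. For $n=0,\dots,N-1$: - $z_n=x_n+\tfrac12\Delta_n$; - $\Delta_{n+1}=\arg\min_{\Delta\in\mathbb{B}_D^d(0)}\ \langle\nabla f(z_n),\Delta\rangle+\tfrac14\langle\nabla^2 f(z_{\pi(n)})(\Delta-\Delta_n),\Delta-\Delta_n\rangle+\tfrac1{2\eta}\|\Delta-v_n\|^2$; - $x_{n+1}=x_n+\Delta_{n+1}$, $y_{n+1}=x_n+\tfrac12\Delta_{n+1}$, $g_{n+1}=\nabla f(y_{n+1})$; - $v_{n+1}=\arg\min_{v\in\mathbb{B}_D^d(0)}\ \langle g_{n+1},v\rangle+\tfrac1{2\eta}\|v-v_n\|^2$. Then set $\bar y^{(k)}=\frac1T\sum_{t=1}^T y_{(k-1)T+t}$ for $k=1,\dots,K$ and return $\hat y=\arg\min_{y\in\{\bar y^{(1)},\dots,\bar y^{(K)}\}}\|\nabla f(y)\|$. Complexity model: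 let $c_H$ and $c_g$ be the costs of one Hessian evaluation and one gradient evaluation; the effective dimension is $\bar d:=c_H/c_g$, with $1\le\bar d\le d$. An algorithm that makes $n_H$ Hessian evaluations and $n_g$ gradient evaluations has total oracle cost $c_Hn_H+c_gn_g=c_g(\bar d\,n_H+n_g)$, and its equivalent gradient complexity is $\bar d\,n_H+n_g$. (In NALEN a new Hessian is evaluated only at iterations $n$ divisible by $m$.) *)

(* Defs.v *)
From HB Require Import structures.
From mathcomp Require Import all_boot all_order all_algebra.
From mathcomp Require Import all_classical all_reals all_analysis.

Set Implicit Arguments.
Unset Strict Implicit.
Unset Printing Implicit Defensive.

Import Order.TTheory GRing.Theory Num.Theory numFieldNormedType.Exports.

Local Open Scope classical_set_scope.
Local Open Scope ring_scope.

(* Points of R^d are row vectors.  The library norm on 'rV[R]_d is the sup norm;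
   it induces the same topology, hence the same notion of differentiability, as
   the Euclidean norm [enorm], which is the one used in all the estimates. *)
Section Euclidean.
Variables (R : realType) (d : nat).
Implicit Types (u v x : 'rV[R]_d) (A : 'M[R]_d) (f : 'rV[R]_d -> R).

Definition dot u v : R := \sum_(i < d) u 0 i * v 0 i.

Definition enorm u : R := Num.sqrt (dot u u).

Definition eball (r : R) : set 'rV[R]_d := [set x | enorm x <= r].

(* Operator norm induced by [enorm]; matrices act on row vectors from the
   right, which does not affect the value. *)
Definition specnorm A : R := sup [set enorm (u *m A) | u in eball 1].

Definition grad f x : 'rV[R]_d := \row_(i < d) 'D_(delta_mx 0 i) f x.

Definition hess f x : 'M[R]_d := 'J (grad f) x.

Definition twice_differentiable f : Prop :=
  (forall x, differentiable f x) /\ (forall x, differentiable (grad f) x).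

Definition hess_lipschitz (L : R) f : Prop :=
  forall x x', specnorm (hess f x - hess f x') <= L * enorm (x - x').

End Euclidean.

Definition is_argmin (R : realType) (V : Type) (A : set V) (F : V -> R) (u : V)
  : Prop := A u /\ (forall w, A w -> F u <= F w).

(* Rounding of a positive real up to a (positive) integer. *)
Definition nceil (R : realType) (x : R) : nat := `|Num.ceil x|%N.

Section NALEN.
Variables (R : realType) (d : nat).
Implicit Types (f : 'rV[R]_d -> R) (yhat : 'rV[R]_d).

(* [ys 0] is irrelevant: the points y_n exist for n >= 1 only. *)
Record trace := Trace {
  xs : nat -> 'rV[R]_d;
  Deltas : nat -> 'rV[R]_d;
  zs : nat -> 'rV[R]_d;
  ys : nat -> 'rV[R]_d;
  vs : nat -> 'rV[R]_d }.

Definition last_refresh (m n : nat) : nat := (n - n %% m)%N.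

(* [s] records an N-step execution.  The subproblem defining Delta_(n+1) may be
   nonconvex, so this is a relation: an execution may use any minimizer.  When
   grad f x0 = 0 the initial vector is 0, as 0^-1 = 0. *)
Definition nalen_run f (x0 : 'rV[R]_d) (N m : nat) (eta D : R) (s : trace) : Prop :=
  [/\ xs s 0 = x0,
      Deltas s 0 = - (D / enorm (grad f x0)) *: grad f x0,
      vs s 0 = Deltas s 0
    & forall n, (n < N)%N ->
      [/\ zs s n = xs s n + 2^-1 *: Deltas s n,
          is_argmin (@eball R d D)
            (fun w => dot (grad f (zs s n)) w
               + 4^-1 * dot ((w - Deltas s n)
                               *m hess f (zs s (last_refresh m n)))
                            (w - Deltas s n)
               + (2 * eta)^-1 * enorm (w - vs s n) ^+ 2)
            (Deltas s n.+1),
          xs s n.+1 = xs s n + Deltas s n.+1,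
          ys s n.+1 = xs s n + 2^-1 *: Deltas s n.+1
        & is_argmin (@eball R d D)
            (fun w => dot (grad f (ys s n.+1)) w
               + (2 * eta)^-1 * enorm (w - vs s n) ^+ 2)
            (vs s n.+1)]].

Definition ybar (T : nat) (s : trace) (k : nat) : 'rV[R]_d :=
  T%:R^-1 *: \sum_(1 <= t < T.+1) ys s (k.-1 * T + t)%N.

Definition nalen_output f (N T : nat) (s : trace) yhat : Prop :=
  is_argmin [set ybar T s k | k in [set k : nat | (1 <= k <= N %/ T)%N]]
    (fun y => enorm (grad f y)) yhat.

(* An execution producing an output exists, and every output of every execution
   is eps-stationary. *)
Definition nalen_finds_stationary f (x0 : 'rV[R]_d) (N m T : nat)
  (eta D eps : R) : Prop :=
  (exists s yhat, nalen_run f x0 N m eta D s /\ nalen_output f N T s yhat) /\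
  (forall s yhat, nalen_run f x0 N m eta D s -> nalen_output f N T s yhat ->
     enorm (grad f yhat) <= eps).

(* Points at which an N-step execution calls the Hessian and gradient oracles;
   the last block of gradients is used to select the output. *)
Definition hess_queries (N m : nat) (s : trace) : seq 'rV[R]_d :=
  [seq zs s n | n <- iota 0 N & (m %| n)%N].

Definition grad_queries (N T : nat) (s : trace) : seq 'rV[R]_d :=
  xs s 0 :: [seq zs s n | n <- iota 0 N]
    ++ [seq ys s n.+1 | n <- iota 0 N]
    ++ [seq ybar T s k | k <- iota 1 (N %/ T)].

Definition oracle_cost (cH cg : R) (N m T : nat) (s : trace) : R :=
  cH * (size (hess_queries N m s))%:R + cg * (size (grad_queries N T s))%:R.

Definition equiv_grad_complexity (dbar : R) (N m T : nat) (s : trace) : R :=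
  dbar * (size (hess_queries N m s))%:R + (size (grad_queries N T s))%:R.

End NALEN.

(* Main.v *)
(* Telescoping the midpoint identity f(x_(n+1)) - f(x_n) ~ <grad f(y_(n+1)), Delta_(n+1)>
   over an episode of length T and comparing with the fixed direction
   u = - D G / |G|, G the sum of the episode's gradients, reduces stationarity
   of the episode average to a regret bound for the linear losses
   <grad f(y_(n+1)), .>.  The pair (Delta, v) is optimistic gradient descent with
   hint h = grad f(z_n) + H (y_(n+1) - z_n), H the lazy Hessian; the hint error is
   at most m L D |Delta_(n+1) - Delta_n|, which the negative quadratic terms of the
   optimistic regret absorb once 1/eta = 4 m L D.  An episode therefore costs
   O(m L D^3), the same order as the averaging error L T^3 D^3 when T^3 ~ m. *)
Require Import Defs.
From HB Require Import structures.
From mathcomp Require Import all_boot all_order all_algebra.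
From mathcomp Require Import all_classical all_reals all_analysis.
From mathcomp Require Import ring lra.

Import Order.TTheory GRing.Theory Num.Theory numFieldNormedType.Exports.

Set Implicit Arguments.
Unset Strict Implicit.
Unset Printing Implicit Defensive.

Local Open Scope classical_set_scope.
Local Open Scope ring_scope.

(** * Euclidean norm and spectral norm *)

Section EuclideanSpace.
Context {R : realType} {d : nat}.
Implicit Types (u v w x y : 'rV[R]_d) (A B : 'M[R]_d).

Lemma dotC u v : dot u v = dot v u.
Proof. by apply: eq_bigr => i _; rewrite mulrC. Qed.

Lemma dotDl u v w : dot (u + v) w = dot u w + dot v w.
Proof. by rewrite -big_split; apply: eq_bigr => i _; rewrite mxE mulrDl. Qed.

Lemma dotZl (a : R) u v : dot (a *: u) v = a * dot u v.
Proof. by rewrite /dot big_distrr; apply: eq_bigr => i _; rewrite /= mxE mulrA. Qed.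

Lemma dotDr u v w : dot u (v + w) = dot u v + dot u w.
Proof. by rewrite dotC dotDl !(dotC u). Qed.

Lemma dotZr (a : R) u v : dot u (a *: v) = a * dot u v.
Proof. by rewrite dotC dotZl dotC. Qed.

Lemma dotNl u v : dot (- u) v = - dot u v.
Proof. by rewrite -scaleN1r dotZl mulN1r. Qed.

Lemma dotNr u v : dot u (- v) = - dot u v.
Proof. by rewrite dotC dotNl dotC. Qed.

Lemma dotBl u v w : dot (u - v) w = dot u w - dot v w.
Proof. by rewrite dotDl dotNl. Qed.

Lemma dotBr u v w : dot u (v - w) = dot u v - dot u w.
Proof. by rewrite dotDr dotNr. Qed.

Lemma dot0l u : dot 0 u = 0.
Proof. by rewrite -(scale0r 0) dotZl mul0r. Qed.

Lemma dot0r u : dot u 0 = 0.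
Proof. by rewrite dotC dot0l. Qed.

Lemma dot_ge0 u : 0 <= dot u u.
Proof. by apply: sumr_ge0 => i _; rewrite -expr2 sqr_ge0. Qed.

Lemma enorm_ge0 u : 0 <= enorm u.
Proof. exact: sqrtr_ge0. Qed.

Lemma sqr_enorm u : enorm u ^+ 2 = dot u u.
Proof. by rewrite sqr_sqrtr // dot_ge0. Qed.

Lemma enorm0 : enorm (0 : 'rV[R]_d) = 0.
Proof. by rewrite /enorm dot0l sqrtr0. Qed.

Lemma enorm_eq0 u : enorm u = 0 -> u = 0.
Proof.
move=> u0; have : dot u u == 0 by rewrite -sqr_enorm u0 expr0n.
rewrite psumr_eq0 => [/allP H|i _]; last by rewrite -expr2 sqr_ge0.
apply/rowP => i; apply/eqP; rewrite mxE -sqrf_eq0 expr2.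
exact: H (mem_index_enum i).
Qed.

Lemma enormZ (a : R) u : enorm (a *: u) = `|a| * enorm u.
Proof.
by rewrite /enorm dotZl dotZr mulrA -expr2 sqrtrM ?sqr_ge0 // sqrtr_sqr.
Qed.

Lemma enormN u : enorm (- u) = enorm u.
Proof. by rewrite /enorm dotNl dotNr opprK. Qed.

Lemma enormB u v : enorm (u - v) = enorm (v - u).
Proof. by rewrite -enormN opprB. Qed.

Lemma cauchy_schwarz u v : dot u v <= enorm u * enorm v.
Proof.
have [/enorm_eq0 ->|u0] := eqVneq (enorm u) 0; first by rewrite enorm0 dot0l mul0r.
have [/enorm_eq0 ->|v0] := eqVneq (enorm v) 0; first by rewrite enorm0 dot0r mulr0.
(* Expanding this square gives [2 |u| |v| (|u| |v| - dot u v) >= 0]. *)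
have := dot_ge0 (enorm v *: u - enorm u *: v).
rewrite !(dotBl, dotBr, dotZl, dotZr) -!sqr_enorm (dotC v u).
have pu : 0 < enorm u by rewrite lt_neqAle eq_sym u0 enorm_ge0.
have pv : 0 < enorm v by rewrite lt_neqAle eq_sym v0 enorm_ge0.
move=> H; rewrite -(ler_pM2l (mulr_gt0 pu pv)); nra.
Qed.

Lemma ler_enormD u v : enorm (u + v) <= enorm u + enorm v.
Proof.
rewrite -(@ler_pXn2r _ 2) ?nnegrE ?addr_ge0 ?enorm_ge0 //.
rewrite sqr_enorm !(dotDl, dotDr) (dotC v u) -!sqr_enorm.
have := cauchy_schwarz u v; lra.
Qed.

Lemma ler_enormB u v : enorm (u - v) <= enorm u + enorm v.
Proof. by rewrite -(enormN v) ler_enormD. Qed.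

Lemma enorm_sum (I : Type) (r : seq I) (P : pred I) (F : I -> 'rV[R]_d) :
  enorm (\sum_(i <- r | P i) F i) <= \sum_(i <- r | P i) enorm (F i).
Proof.
elim/big_rec2: _ => [|i y1 y2 _ H]; first by rewrite enorm0.
by apply: le_trans (ler_enormD _ _) _; rewrite lerD2l.
Qed.

Lemma enorm_coord u i : `|u 0 i| <= enorm u.
Proof.
rewrite -sqrtr_sqr ler_wsqrtr // /dot (bigD1 i) //= expr2 lerDl.
by apply: sumr_ge0 => j _; rewrite -expr2 sqr_ge0.
Qed.

Lemma enorm_le_sum u : enorm u <= \sum_i `|u 0 i|.
Proof.
rewrite {1}(row_sum_delta u); apply: le_trans (enorm_sum _ _ _) _.
apply: ler_sum => i _; rewrite enormZ.
suff -> : enorm (delta_mx 0 i : 'rV[R]_d) = 1 by rewrite mulr1.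
rewrite /enorm /dot (bigD1 i) //= !mxE !eqxx mulr1 big1 ?addr0 ?sqrtr1 //.
by move=> j /negPf ji; rewrite !mxE ji andbF mulr0.
Qed.

(** An unbounded set would give [sup] its default value 0; the sum of the absolute values of the
    entries is a bound that rules this out. *)
Lemma specnorm_has_sup A : has_sup [set enorm (u *m A) | u in eball 1].
Proof.
split; first by exists (enorm (0 *m A)), 0 => //=; rewrite /eball /= enorm0 ler01.
exists (\sum_j \sum_i `|A i j|) => _ [u /= u1 <-].
apply: le_trans (enorm_le_sum _) _; apply: ler_sum => j _; rewrite mxE.
apply: le_trans (ler_norm_sum _ _ _) _; apply: ler_sum => i _.
rewrite normrM -[leRHS]mul1r ler_wpM2r // (le_trans _ u1) ?enorm_coord //.
Qed.

Lemma enorm_mulmx A u : enorm (u *m A) <= specnorm A * enorm u.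
Proof.
have [/enorm_eq0 ->|u0] := eqVneq (enorm u) 0.
  by rewrite mul0mx enorm0 mulr0.
have pu : 0 < enorm u by rewrite lt_neqAle eq_sym u0 enorm_ge0.
rewrite -ler_pdivrMr //.
have -> : enorm (u *m A) / enorm u = enorm (((enorm u)^-1 *: u) *m A).
  by rewrite -scalemxAl enormZ ger0_norm ?invr_ge0 ?enorm_ge0 // mulrC.
apply: sup_upper_bound; first exact: specnorm_has_sup.
exists ((enorm u)^-1 *: u) => //=.
by rewrite /eball /= enormZ ger0_norm ?invr_ge0 ?enorm_ge0 // mulVf.
Qed.

End EuclideanSpace.

(** * Taylor estimates under a Lipschitz Hessian *)

Section Calculus.
Context {R : realType}.

Lemma is_derive_line (V W : normedModType R) (F : V -> W) (x h : V) (t : R) l :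
  is_derive (x + t *: h) h F l ->
  is_derive t 1 (fun s : R => F (x + s *: h)) l.
Proof.
move=> [dF <-].
have E : (fun k : R => k^-1 *: (F (x + (k *: 1 + t) *: h) - F (x + t *: h)))
       = (fun k : R => k^-1 *: (F (k *: h + (x + t *: h)) - F (x + t *: h))).
  by apply/funext => k; rewrite [k *: 1]mulr1 scalerDl addrCA.
by split; rewrite /derivable /derive /= E.
Qed.

Lemma mean_value_unit (phi dphi : R -> R) :
  (forall t : R, is_derive t 1 phi (dphi t)) ->
  exists2 t, 0 <= t <= 1 & phi 1 - phi 0 = dphi t.
Proof.
move=> dphiP; have [] := @MVT R phi dphi 0 1 ltr01 (fun t _ => dphiP t).
  apply: derivable_within_continuous => t _; by have ? := dphiP t.
move=> t; rewrite in_itv /= => /andP[t0 t1] ->.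
by exists t; rewrite ?subr0 ?mulr1 // !ltW.
Qed.

Variable d : nat.
Implicit Types (u v x h e : 'rV[R]_d).

(** The mean value theorem is scalar, so vector estimates are proved against test vectors [e]; the
    choice [e = u] recovers the norm. *)
Lemma enorm_le_dot u (c : R) : 0 <= c ->
  (forall e, dot u e <= c * enorm e) -> enorm u <= c.
Proof.
move=> c0 /(_ u); rewrite -sqr_enorm expr2.
have [-> //|u0] := eqVneq (enorm u) 0.
by rewrite ler_pM2r // lt_neqAle eq_sym u0 enorm_ge0.
Qed.

Variables (f : 'rV[R]_d -> R) (L : R).
Hypotheses (L0 : 0 <= L) (df : twice_differentiable f) (HL : hess_lipschitz L f).

Lemma is_derive_line_dot x h (t : R) :
  is_derive t 1 (fun s : R => f (x + s *: h)) (dot (grad f (x + t *: h)) h).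
Proof.
have dfx := df.1 (x + t *: h).
apply: is_derive_line; apply: DeriveDef; first exact: diff_derivable.
move: (x + t *: h) dfx => y dfy; rewrite deriveE // {1}(row_sum_delta h) linear_sum /dot.
by apply: eq_bigr => i _; rewrite linearZ /= mxE deriveE // mulrC.
Qed.

Lemma is_derive_line_grad x h e (t : R) :
  is_derive t 1 (fun s : R => dot (grad f (x + s *: h)) e)
    (dot (h *m hess f (x + t *: h)) e).
Proof.
have dgx := df.2 (x + t *: h).
apply: (@is_derive_line _ _ (fun y => dot (grad f y) e)).
have dg : derivable (grad f) (x + t *: h) h by exact: diff_derivable.
have dgi := (derivable_mxP (grad f) (x + t *: h) h).1 dg.
rewrite /hess -deriveEjacobian // (derive_mx dg) /dot.
have -> : (fun y => \sum_(i < d) grad f y 0 i * e 0 i) =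
  \sum_(i < d) (fun y => grad f y 0 i * e 0 i).
  by apply/funext => y; rewrite fct_sumE.
apply: is_derive_sum => i; rewrite mxE.
have -> : (fun y => grad f y 0 i * e 0 i) = e 0 i \*: (fun y => grad f y 0 i).
  by apply/funext => y /=; rewrite mulrC.
rewrite mulrC; apply: is_deriveZ; apply: DeriveDef => //; exact: dgi.
Qed.

Lemma hess_lipschitz_mulmx x y u :
  enorm (u *m hess f x - u *m hess f y) <= L * enorm (x - y) * enorm u.
Proof.
rewrite -mulmxBr; apply: le_trans (enorm_mulmx _ _) _.
by rewrite ler_wpM2r ?enorm_ge0 // HL.
Qed.

(** The mean value theorem for [dot (grad f (x + t *: h)) e] leaves only the Hessian drift over a
    distance [t * enorm h]. Bounding [t] by 1 gives the constant [L] instead of [L / 2]. *)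
Lemma grad_taylor x h :
  enorm (grad f (x + h) - grad f x - h *m hess f x) <= L * enorm h ^+ 2.
Proof.
apply: enorm_le_dot => [|e]; first by rewrite mulr_ge0 // sqr_ge0.
have [t /andP[t0 t1]] := mean_value_unit (is_derive_line_grad x h e).
rewrite scale1r scale0r addr0 !dotBl => ->; rewrite -dotBl.
apply: le_trans (cauchy_schwarz _ _) _; rewrite ler_wpM2r ?enorm_ge0 //.
apply: le_trans (hess_lipschitz_mulmx _ _ _) _.
rewrite addrAC subrr add0r enormZ ger0_norm // expr2 mulrA.
rewrite ler_wpM2r ?enorm_ge0 // ler_wpM2l // ler_piMl ?enorm_ge0 //.
Qed.

(** The derivative in [t] of [f (x + t *: h) - f (x - t *: h)] pairs [h] with a sum of gradients at
    two points symmetric about [x]. Their Hessian corrections cancel, so the error is cubic. *)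
Lemma central_difference_le x h :
  f (x + h) - f (x - h) <= 2 * dot (grad f x) h + 2 * L * enorm h ^+ 3.
Proof.
have [t /andP[t0 t1]] := mean_value_unit (fun t : R =>
  is_deriveB (is_derive_line_dot x h t) (is_derive_line_dot x (- h) t)).
rewrite /= !fctE !scale1r !scale0r !addr0 subrr subr0 => ->.
rewrite dotNr opprK.
have K (w : 'rV[R]_d) : enorm w <= enorm h ->
  dot (grad f (x + w) - grad f x - w *m hess f x) h <= L * enorm h ^+ 3.
  move=> wh; apply: le_trans (cauchy_schwarz _ _) _.
  rewrite exprSr mulrA ler_wpM2r ?enorm_ge0 //.
  apply: le_trans (grad_taylor _ _) _.
  by rewrite ler_wpM2l // lerXn2r ?nnegrE ?enorm_ge0.
have th : enorm (t *: h) <= enorm h.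
  by rewrite enormZ ger0_norm // ler_piMl ?enorm_ge0.
have thN : enorm (- (t *: h)) <= enorm h by rewrite enormN.
have := lerD (K _ th) (K _ thN); rewrite mulNmx !dotBl !dotNl scalerN; lra.
Qed.

(** Mean value theorem for [f (x + v + t *: u) - f (x + t *: u)]: when both gradients are linearized
    at [x], the contributions of [t *: u] cancel and that of [v] remains. Testing against [u] and
    [- u] gives the two sides. *)
Lemma second_difference_bound x u v :
  `|f (x + u + v) - f (x + u) - f (x + v) + f x - dot (v *m hess f x) u|
    <= 2 * L * (enorm u + enorm v) ^+ 3.
Proof.
have [t /andP[t0 t1]] := mean_value_unit (fun t : R =>
  is_deriveB (is_derive_line_dot (x + v) u t) (is_derive_line_dot x u t)).
rewrite /= !fctE !scale1r !scale0r !addr0 (addrAC x v u) => E.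
have -> : f (x + u + v) - f (x + u) - f (x + v) + f x
  = f (x + u + v) - f (x + u) - (f (x + v) - f x) by ring.
rewrite E.
set M := enorm u + enorm v.
have M0 : 0 <= M by rewrite addr_ge0 ?enorm_ge0.
have K (w e : 'rV[R]_d) : enorm w <= M -> enorm e <= M ->
  dot (grad f (x + w) - grad f x - w *m hess f x) e <= L * M ^+ 3.
  move=> wh eh; apply: le_trans (cauchy_schwarz _ _) _.
  rewrite exprSr mulrA ler_pM ?enorm_ge0 //.
  apply: le_trans (grad_taylor _ _) _.
  by rewrite ler_wpM2l // lerXn2r ?nnegrE ?enorm_ge0.
have tu : enorm (t *: u) <= enorm u.
  by rewrite enormZ ger0_norm // ler_piMl ?enorm_ge0.
have uM : enorm u <= M by rewrite lerDl enorm_ge0.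
have NuM : enorm (- u) <= M by rewrite enormN.
have tuM := le_trans tu uM.
have vtuM : enorm (v + t *: u) <= M.
  by apply: le_trans (ler_enormD _ _) _; rewrite addrC lerD2r.
have := lerD (K _ _ vtuM uM) (K _ _ tuM NuM).
have := lerD (K _ _ vtuM NuM) (K _ _ tuM uM).
rewrite (addrA x) mulmxDl !(dotDl, dotNl) !dotNr ler_norml. lra.
Qed.

(* The second difference of f at x along s u, s v is symmetric in u and v and
   equals s^2 <v H, u> up to O(s^3). *)
Lemma hess_sym x u v : dot (u *m hess f x) v = dot (v *m hess f x) u.
Proof.
set a := dot _ v; set b := dot _ u; set M := enorm u + enorm v.
have M0 : 0 <= M by rewrite addr_ge0 ?enorm_ge0.
have K (s : R) : 0 < s -> `|a - b| <= s * (4 * L * M ^+ 3).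
  move=> s0.
  have := second_difference_bound x (s *: u) (s *: v).
  have := second_difference_bound x (s *: v) (s *: u).
  rewrite !enormZ (gtr0_norm s0) -!mulrDr (addrC (enorm v)) -/M (addrAC x (s *: v)).
  rewrite -!scalemxAl !dotZl !dotZr -/a -/b !ler_norml.
  move=> /andP[A1 A2] /andP[B1 B2].
  have s2 : 0 < s ^+ 2 by rewrite exprn_gt0.
  by apply/andP; split; rewrite -(ler_pM2l s2); lra.
apply/eqP; rewrite -subr_eq0 -normr_eq0; apply/eqP/le_anti; rewrite normr_ge0 andbT.
have C0 : 0 <= 4 * L * M ^+ 3 by rewrite mulr_ge0 ?exprn_ge0 // mulr_ge0.
apply/ler_addgt0Pr => e e0; rewrite add0r.
(* The [+ 1] keeps the divisor positive when [L] or [M] is zero. *)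
have C1 : 0 < 4 * L * M ^+ 3 + 1 by lra.
apply: le_trans (K (e / (4 * L * M ^+ 3 + 1)) (divr_gt0 e0 C1)) _.
rewrite mulrAC ler_pdivrMr //; nra.
Qed.

(** Along the line through [x] in direction [grad f x], the derivative at 0 is the squared gradient
    norm. This settles the case of zero initial gap. *)
Lemma grad_eq0_at_min x : (forall y, f x <= f y) -> grad f x = 0.
Proof.
move=> fmin; apply/enorm_eq0/eqP; rewrite -sqrf_eq0 sqr_enorm; apply/eqP.
have D t := is_derive_line_dot x (grad f x) t.
have D0 : is_derive (0 : R) 1 (fun s : R => f (x + s *: grad f x)) 0.
  apply: (@derive1_at_min _ _ (-1) 1) => [|t _||t _]; first by lra.
  - by have ? := D t.
  - by rewrite in_itv /=; lra.
  - by rewrite scale0r addr0 fmin.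
by case: (D 0) => _; case: D0 => _ ->; rewrite scale0r addr0 => <-.
Qed.

End Calculus.

(** * Minimization over Euclidean balls *)

Section Minimizers.
Context {R : realType} {d : nat}.
Implicit Types (u v w x y : 'rV[R]_d).

Lemma continuous_add (T : topologicalType) (F G : T -> R) :
  continuous F -> continuous G -> continuous (fun t => F t + G t).
Proof. by move=> cF cG t; apply: cvgD; [exact: cF | exact: cG]. Qed.

Lemma continuous_mul (T : topologicalType) (F G : T -> R) :
  continuous F -> continuous G -> continuous (fun t => F t * G t).
Proof. by move=> cF cG t; apply: cvgM; [exact: cF | exact: cG]. Qed.

Lemma continuous_sum (T : topologicalType) (I : Type) (r : seq I)
    (F : I -> T -> R) : (forall i, continuous (F i)) ->
  continuous (fun t => \sum_(i <- r) F i t).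
Proof.
move=> cF; elim: r => [|i r IH] t.
  have -> : (fun t => \sum_(i <- [::]) F i t) = cst 0.
    by apply/funext => y; rewrite big_nil.
  exact: cst_continuous.
have -> : (fun t => \sum_(i <- i :: r) F i t)
    = (fun t => F i t + \sum_(i <- r) F i t).
  by apply/funext => y; rewrite big_cons.
by move: t; apply: continuous_add.
Qed.

Lemma continuous_dot (T : topologicalType) (F G : T -> 'rV[R]_d) :
  (forall i, continuous (fun t => F t 0 i)) ->
  (forall i, continuous (fun t => G t 0 i)) ->
  continuous (fun t => dot (F t) (G t)).
Proof.
by move=> cF cG; apply: continuous_sum => i; apply: continuous_mul.
Qed.

(** One form covers both subproblems: the one defining [vs] is the case [A = 0], [p = 0]. *)
Lemma continuous_quadratic (A : 'M[R]_d) g p q (c : R) :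
  continuous (fun w => dot g w + 4^-1 * dot ((w - p) *m A) (w - p)
                       + c * enorm (w - q) ^+ 2).
Proof.
have cc i : continuous (fun w : 'rV[R]_d => w 0 i).
  exact: (@coord_continuous R 1 d 0 i).
have cst (a : R) : continuous (fun _ : 'rV[R]_d => a) by exact: cst_continuous.
have cB p' i : continuous (fun w : 'rV[R]_d => (w - p') 0 i).
  have -> : (fun w : 'rV[R]_d => (w - p') 0 i)
      = (fun w : 'rV[R]_d => w 0 i + (- p' 0 i)).
    by apply/funext => y; rewrite !mxE.
  by apply: continuous_add.
have -> : (fun w => dot g w + 4^-1 * dot ((w - p) *m A) (w - p)
                    + c * enorm (w - q) ^+ 2)
    = (fun w => dot g w + 4^-1 * dot ((w - p) *m A) (w - p)
                + c * dot (w - q) (w - q)).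
  by apply/funext => w; rewrite sqr_enorm.
apply: continuous_add; first apply: continuous_add.
- by apply: continuous_dot.
- apply: continuous_mul => //; apply: continuous_dot => // j.
  have -> : (fun w => ((w - p) *m A) 0 j)
      = (fun w => \sum_i (w - p) 0 i * A i j).
    by apply/funext => y; rewrite mxE.
  by apply: continuous_sum => i; apply: continuous_mul.
- by apply: continuous_mul => //; apply: continuous_dot.
Qed.

Lemma eball_compact (r : R) : compact (@eball R d r).
Proof.
apply: bounded_closed_compact.
  exists r; split; first exact: num_real.
  move=> M rM x /= xr; rewrite [leLHS]/Num.Def.normr /= mx_normrE.
  have r0 := le_trans (enorm_ge0 x) xr.
  apply: bigmax_le => [|[i j] _]; first by lra.
  by rewrite /= (ord1 i) (le_trans (enorm_coord x j)) // (le_trans xr) // ltW.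
have c : continuous (@enorm R d).
  move=> x; apply: (@continuous_comp _ _ _ (fun u : 'rV[R]_d => dot u u) Num.sqrt).
    by apply: continuous_dot => i; exact: (@coord_continuous R 1 d 0 i).
  exact: sqrt_continuous.
have -> : @eball R d r = @enorm R d @^-1` [set x | x <= r] by [].
by apply: (closed_comp _ (@closed_le R r)) => x _; exact: c.
Qed.

Lemma exists_argmin_eball (r : R) (F : 'rV[R]_d -> R) : 0 <= r ->
  continuous F -> exists w, is_argmin (eball r) F w.
Proof.
move=> r0 cF; have [||x xr xm] := @EVT_min_rV R d F _ _ (@eball_compact r).
- by exists 0; rewrite /eball /= enorm0.
- exact: continuous_subspaceT.
- by exists x; split=> [|w wr]; [rewrite inE in xr | apply: xm; rewrite inE].
Qed.

Lemma segment_eball (r t : R) u w : 0 <= t <= 1 ->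
  eball r u -> eball r w -> eball r (u + t *: (w - u)).
Proof.
rewrite /eball /= => /andP[t0 t1] ur wr.
have -> : u + t *: (w - u) = (1 - t) *: u + t *: w.
  by rewrite scalerBr scalerBl scale1r -addrA (addrC (- _)).
apply: le_trans (ler_enormD _ _) _; rewrite !enormZ !ger0_norm ?subr_ge0 //.
nra.
Qed.

(* Only minimality along segments is used, so this also applies to
   nonconvex quadratics. *)
Lemma argmin_quadratic_variation (r c : R) (A : 'M[R]_d) g p q u w :
  (forall x y, dot (x *m A) y = dot (y *m A) x) ->
  is_argmin (eball r) (fun w => dot g w + 4^-1 * dot ((w - p) *m A) (w - p)
                                + c * enorm (w - q) ^+ 2) u ->
  eball r w ->
  0 <= dot (g + 2^-1 *: ((u - p) *m A) + (2 * c) *: (u - q)) (w - u).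
Proof.
move=> sA [ur um] wr; set h := w - u.
set s := dot _ h; set k := 4^-1 * dot (h *m A) h + c * dot h h.
(* The objective at [u + t *: h] exceeds its value at [u] by [t * (s + t * k)]; symmetry of [A]
   merges the two cross terms into [s]. *)
have K (t : R) : 0 < t <= 1 -> 0 <= s + t * k.
  move=> /andP[t0 t1]; have t01 : 0 <= t <= 1 by rewrite ltW.
  have := um _ (segment_eball t01 ur wr).
  rewrite -/h (addrAC u (t *: h) (- p)) (addrAC u (t *: h) (- q)) !sqr_enorm.
  rewrite /s /k; clearbody h; move: (u - p) (u - q) => a b.
  rewrite (mulmxDl a) -scalemxAl !(dotDl, dotDr, dotZl, dotZr).
  rewrite (dotC h b) (sA h a) -(@pmulr_rge0 _ t) //; lra.
(* If [s < 0], the choice [t = - s / (2 * k)] yields [s / 2 < 0]; if this [t] exceeds 1, then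
   [k < - s / 2] and [t = 1] already gives a contradiction. *)
rewrite leNgt; apply/negP => s0.
have k0 : 0 < k by have := K 1 (introT andP (conj ltr01 (lexx 1))); lra.
have e : - s / (2 * k) * k = - s / 2 by field; lra.
have sk : 0 < - s / (2 * k) by apply: divr_gt0; lra.
have [k1|k1] := lerP (- s / (2 * k)) 1.
  by have := K _ (introT andP (conj sk k1)); lra.
have := K 1 (introT andP (conj ltr01 (lexx 1))).
have : 1 * k <= - s / (2 * k) * k by rewrite ler_pM2r // ltW.
lra.
Qed.

End Minimizers.

(** * Regret and descent along an execution *)

Section Averaging.
Context {R : realType} {d : nat}.
Implicit Types (u v w x y z g h : 'rV[R]_d).

(** Split [dot g (x - u)] into [dot (g - h) (x - v') + dot h (x - v') + dot g (v' - u)], bound the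
    last two terms by the optimality conditions and apply the three-point identity to each; the two
    copies of [|v' - v|^2] cancel. *)
Lemma optimistic_regret_step (B : R) g h x v v' u :
  0 <= dot (h + (2 * B) *: (x - v)) (v' - x) ->
  0 <= dot (g + (2 * B) *: (v' - v)) (u - v') ->
  dot g (x - u) <= dot (g - h) (x - v')
    - B * (enorm (x - v) ^+ 2 + enorm (x - v') ^+ 2)
    + B * (enorm (u - v) ^+ 2 - enorm (u - v') ^+ 2).
Proof.
rewrite !sqr_enorm !(dotBl, dotBr, dotDl, dotDr, dotZl, dotNl, dotNr).
rewrite ?(dotC v x) ?(dotC v' x) ?(dotC v u) ?(dotC v' u) ?(dotC v' v) ?(dotC u x).
nra.
Qed.

Variables (f : 'rV[R]_d -> R) (L : R).
Hypotheses (L0 : 0 <= L) (df : twice_differentiable f) (HL : hess_lipschitz L f).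

(** Taylor's formula at [z], plus the cost of replacing the Hessian at [z] by the stale one at
    [w]. *)
Lemma lazy_grad_taylor z w p :
  enorm (grad f (z + p) - (grad f z + p *m hess f w))
    <= L * (enorm p + enorm (z - w)) * enorm p.
Proof.
have -> : grad f (z + p) - (grad f z + p *m hess f w)
  = (grad f (z + p) - grad f z - p *m hess f z)
    + (p *m hess f z - p *m hess f w).
  by rewrite addrA subrK opprD addrA.
apply: le_trans (ler_enormD _ _) _.
rewrite mulrDr mulrDl -(mulrA L (enorm p)) -expr2 lerD //.
  exact: grad_taylor.
exact: hess_lipschitz_mulmx.
Qed.

(** Every gradient is expanded at the mean [y]; the deviations [Y t - y] sum to zero, which removes
    the linear terms. *)
Lemma grad_average (T : nat) (Y : 'I_T -> 'rV[R]_d) y (r : R) :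
  \sum_t Y t = T%:R *: y -> (forall t, enorm (Y t - y) <= r) ->
  enorm (\sum_t grad f (Y t) - T%:R *: grad f y) <= T%:R * (L * r ^+ 2).
Proof.
move=> Yy Yr.
have -> : \sum_t grad f (Y t) - T%:R *: grad f y
  = \sum_t (grad f (y + (Y t - y)) - grad f y - (Y t - y) *m hess f y).
  rewrite !big_split /= !sumrN -mulmx_suml big_split /= Yy sumrN !sumr_const.
  rewrite card_ord !scaler_nat subrr mul0mx subr0; congr (_ - _).
  by apply: eq_bigr => t _; rewrite subrKC.
apply: le_trans (enorm_sum _ _ _) _.
rewrite mulr_natl -[X in _ *+ X]card_ord -sumr_const; apply: ler_sum => t _.
apply: le_trans (grad_taylor L0 df HL _ _) _.
by rewrite ler_wpM2l // lerXn2r ?nnegrE ?enorm_ge0 // (le_trans (enorm_ge0 _) (Yr t)).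
Qed.

End Averaging.

(** * Estimates along a fixed execution of positive radius *)

Section Run.
Context {R : realType} {d : nat}.
Variables (f : 'rV[R]_d -> R) (L : R).
Hypotheses (L0 : 0 < L) (df : twice_differentiable f) (HL : hess_lipschitz L f).
Variables (x0 : 'rV[R]_d) (N m : nat) (eta D : R) (s : trace R d).
Hypotheses (D0 : 0 < D) (m1 : (1 <= m)%N) (etaE : eta = 4^-1 * (1 / (m%:R * L * D))).
Hypothesis run : nalen_run f x0 N m eta D s.

Let M := m%:R * L * D.

Let m_ge1 : 1 <= m%:R :> R. Proof. by rewrite ler1n. Qed.

Let M0 : 0 < M.
Proof. by rewrite !mulr_gt0 // (lt_le_trans ltr01). Qed.

Let two_eta : (2 * eta)^-1 = 2 * M.
Proof. by rewrite etaE /M; field; rewrite !gt_eqF // (lt_le_trans ltr01). Qed.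

Lemma run_Delta n : (n <= N)%N -> enorm (Deltas s n) <= D.
Proof.
case: run => _ DE _ H; case: n => [_|n nN]; last by case: (H n nN) => _ [].
rewrite DE; have [->|g0] := eqVneq (enorm (grad f x0)) 0.
  by rewrite invr0 mulr0 oppr0 scale0r enorm0 ltW.
by rewrite enormZ normrN ger0_norm ?divfK // divr_ge0 ?enorm_ge0 // ltW.
Qed.

Lemma run_v n : (n <= N)%N -> enorm (vs s n) <= D.
Proof.
case: n => [_|n nN]; first by case: run => _ _ -> _; exact: run_Delta.
by case: run => _ _ _ /(_ _ nN)[_ _ _ _ []].
Qed.

Lemma run_x_dist i k : (i + k <= N)%N ->
  enorm (xs s (i + k) - xs s i) <= k%:R * D.
Proof.
elim: k => [|k IH] ikN; first by rewrite addn0 subrr enorm0 mul0r.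
rewrite addnS in ikN *.
have [_ _ _ /(_ _ ikN)[_ _ -> _ _]] := run.
rewrite addrAC -natr1 mulrDl mul1r; apply: le_trans (ler_enormD _ _) _.
by rewrite lerD ?run_Delta // IH // ltnW.
Qed.

Let half_le (u v : 'rV[R]_d) : enorm u <= D -> enorm v <= D ->
  enorm (2^-1 *: u - 2^-1 *: v) <= D.
Proof.
move=> uD vD; rewrite -scalerBr enormZ ger0_norm ?invr_ge0 //.
have := ler_enormB u v; lra.
Qed.

(** The last refresh is at most [m - 1] steps back, and the two half-steps add at most one further
    [D]. *)
Lemma run_z_dist n : (n < N)%N ->
  enorm (zs s n - zs s (last_refresh m n)) <= m%:R * D.
Proof.
move=> nN; set p := last_refresh m n.
have pn : (p <= n)%N by exact: leq_subr.
have [_ _ _ H] := run.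
have [-> _ _ _ _] := H _ nN; have [-> _ _ _ _] := H _ (leq_ltn_trans pn nN).
rewrite opprD addrACA; apply: le_trans (ler_enormD _ _) _.
have := run_x_dist (i := p) (k := n - p); rewrite subnKC // => /(_ (ltnW nN)) xD.
have := half_le (run_Delta (ltnW nN)) (run_Delta (ltnW (leq_ltn_trans pn nN))).
have : (n - p)%:R + 1 <= m%:R :> R.
  by rewrite natr1 ler_nat /p /last_refresh subKn ?leq_mod // ltn_pmod.
move=> /(ler_wpM2r (ltW D0)); lra.
Qed.

Lemma run_y_dist i j (T : nat) : (i < N)%N -> (j < N)%N ->
  (i < j + T)%N -> (j < i + T)%N ->
  enorm (ys s i.+1 - ys s j.+1) <= T%:R * D.
Proof.
wlog ij : i j / (j <= i)%N.
  move=> W iN jN iT jT; case/orP: (leq_total j i) => ij; first exact: W.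
  by rewrite enormB; apply: W.
move=> iN jN ijT _.
have [_ _ _ H] := run.
have [_ _ _ -> _] := H _ iN; have [_ _ _ -> _] := H _ jN.
rewrite opprD addrACA; apply: le_trans (ler_enormD _ _) _.
have := run_x_dist (i := j) (k := i - j); rewrite subnKC // => /(_ (ltnW iN)) xD.
have := half_le (run_Delta iN) (run_Delta jN).
have : (i - j)%:R + 1 <= T%:R :> R.
  by rewrite natr1 ler_nat -(ltn_add2l j) subnKC.
move=> /(ler_wpM2r (ltW D0)); lra.
Qed.

(** The proximal weight is [2 * M]. The hint error is at most [M * (a + b) * b']; its [a] and [b']
    parts are absorbed by the negative terms, and the remaining [b ^+ 2] telescopes, since [b'] is
    the [b] of the next step. *)
Lemma run_regret_step n u : (n < N)%N -> enorm u <= D ->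
  dot (grad f (ys s n.+1)) (Deltas s n.+1 - u)
    <= 2 * M * (enorm (u - vs s n) ^+ 2 - enorm (u - vs s n.+1) ^+ 2)
     + 2^-1 * M * (enorm (Deltas s n - vs s n) ^+ 2
                   - enorm (Deltas s n.+1 - vs s n.+1) ^+ 2).
Proof.
move=> nN uD; have [_ _ _ /(_ _ nN)[zE argD xE yE argv]] := run.
have sym (x y : 'rV[R]_d) : dot (x *m hess f (zs s (last_refresh m n))) y
    = dot (y *m hess f (zs s (last_refresh m n))) x.
  exact: (hess_sym (ltW L0) df HL).
have vD : eball D (vs s n.+1) by exact: run_v.
have o1 := argmin_quadratic_variation sym argD vD.
(* The subproblem for [vs] is treated as a quadratic one with zero matrix. *)
have o2 : 0 <= dot (grad f (ys s n.+1) + (2 * (2 * M)) *: (vs s n.+1 - vs s n))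
                   (u - vs s n.+1).
  have := @argmin_quadratic_variation _ _ D (2 * eta)^-1 0 (grad f (ys s n.+1))
    0 (vs s n) (vs s n.+1) u.
  rewrite mulmx0 scaler0 addr0 two_eta; apply=> //.
  - by move=> x y; rewrite !mulmx0 !dot0l.
  - rewrite (_ : (fun w => _) = fun w => dot (grad f (ys s n.+1)) w
       + (2 * eta)^-1 * enorm (w - vs s n) ^+ 2) //.
    by apply/funext => w; rewrite mulmx0 dot0l mulr0 addr0 two_eta.
rewrite two_eta in o1.
have := optimistic_regret_step o1 o2.
(* With this [p], the factor [4^-1] in the subproblem makes the gradient of its first two terms the
   lazy Taylor model of [grad f] at [ys s n.+1]. *)
set p := 2^-1 *: (Deltas s n.+1 - Deltas s n).
have pE : ys s n.+1 = zs s n + p.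
  by rewrite yE zE /p scalerBr addrA addrAC addrK.
rewrite scalemxAl -/p.
set err := dot (grad f _ - (_ + _)) _.
set a := enorm (Deltas s n.+1 - vs s n).
set b := enorm (Deltas s n - vs s n).
set b' := enorm (Deltas s n.+1 - vs s n.+1).
have p2 : enorm p = 2^-1 * enorm (Deltas s n.+1 - Deltas s n).
  by rewrite enormZ ger0_norm // invr_ge0.
have pab : enorm p <= 2^-1 * (a + b).
  rewrite p2 ler_pM2l ?invr_gt0 //.
  have := ler_enormB (Deltas s n.+1 - vs s n) (Deltas s n - vs s n).
  by rewrite opprB addrA subrK.
have pD : enorm p <= D.
  have := ler_enormB (Deltas s n.+1) (Deltas s n); rewrite p2.
  have := run_Delta nN; have := run_Delta (ltnW nN); lra.
have b'0 : 0 <= b' := enorm_ge0 _.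
have errM : err <= M * (a + b) * b'.
  apply: le_trans (cauchy_schwarz _ _) _; rewrite -/b' ler_wpM2r //.
  rewrite pE; apply: le_trans (lazy_grad_taylor (ltW L0) df HL _ _ _) _.
  have zD := run_z_dist nN.
  have k : enorm p + enorm (zs s n - zs s (last_refresh m n)) <= 2 * (m%:R * D).
    have : D <= m%:R * D by rewrite ler_peMl // ltW.
    lra.
  have -> : M * (a + b) = L * (2 * (m%:R * D)) * (2^-1 * (a + b)).
    by rewrite /M; field.
  apply: ler_pM => //; rewrite ?enorm_ge0 //.
    by rewrite mulr_ge0 ?addr_ge0 ?enorm_ge0 // ltW.
  by rewrite ler_pM2l.
have : (a + b) * b' <= 2^-1 * a ^+ 2 + 2^-1 * b ^+ 2 + b' ^+ 2.
  have := sqr_ge0 (a - b'); have := sqr_ge0 (b - b'); nra.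
rewrite -(ler_pM2l M0).
have : 0 <= M * a ^+ 2 by rewrite mulr_ge0 ?sqr_ge0 // ltW.
have : 0 <= M * b' ^+ 2 by rewrite mulr_ge0 ?sqr_ge0 // ltW.
move: errM; rewrite -mulrA; lra.
Qed.

(** [ys s n.+1] is the midpoint of the step, so the central difference applies with half-step at
    most [D / 2], and [2 * L * (D / 2) ^+ 3] is the error term. *)
Lemma run_descent n : (n < N)%N ->
  f (xs s n.+1) - f (xs s n)
    <= dot (grad f (ys s n.+1)) (Deltas s n.+1) + 4^-1 * (L * D ^+ 3).
Proof.
move=> nN; have [_ _ _ /(_ _ nN)[_ _ xE yE _]] := run.
have := central_difference_le (ltW L0) df HL (ys s n.+1) (2^-1 *: Deltas s n.+1).
have -> : ys s n.+1 + 2^-1 *: Deltas s n.+1 = xs s n.+1.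
  by rewrite yE xE -addrA -scalerDl (_ : _ + _ = 1) ?scale1r //; lra.
have -> : ys s n.+1 - 2^-1 *: Deltas s n.+1 = xs s n by rewrite yE addrK.
rewrite dotZr enormZ ger0_norm ?invr_ge0 //.
have : enorm (Deltas s n.+1) ^+ 3 <= D ^+ 3.
  by rewrite lerXn2r ?nnegrE ?enorm_ge0 ?(ltW D0) // run_Delta.
rewrite -(ler_pM2l L0); rewrite exprMn.
have -> : (2^-1 : R) ^+ 3 = 8^-1 by field.
lra.
Qed.

(** Descent and regret are summed and both potentials telescope. Squared distances in the ball are
    at most [4 * D ^+ 2], so the initial potentials cost [8 + 2 = 10] times [M * D ^+ 2]. *)
Lemma run_episode a T u : (a + T <= N)%N -> enorm u <= D ->
  f (xs s (a + T)) - f (xs s a)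
    <= dot (\sum_(t < T) grad f (ys s (a + t).+1)) u
       + 10 * M * D ^+ 2 + T%:R * (4^-1 * (L * D ^+ 3)).
Proof.
move=> aTN uD.
have two (v w : 'rV[R]_d) : enorm v <= D -> enorm w <= D ->
    enorm (v - w) ^+ 2 <= 4 * D ^+ 2.
  move=> vD wD; have := ler_enormB v w; have := enorm_ge0 (v - w); nra.
have tel k : (k <= T)%N -> f (xs s (a + k)) - f (xs s a)
    <= dot (\sum_(t < k) grad f (ys s (a + t).+1)) u
       + 2 * M * (enorm (u - vs s a) ^+ 2 - enorm (u - vs s (a + k)) ^+ 2)
       + 2^-1 * M * (enorm (Deltas s a - vs s a) ^+ 2
                   - enorm (Deltas s (a + k) - vs s (a + k)) ^+ 2)
       + k%:R * (4^-1 * (L * D ^+ 3)).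
  elim: k => [_|k IH kT].
    by rewrite big_ord0 dot0l addn0 !subrr !mulr0 mul0r !addr0.
  have akN : (a + k < N)%N by rewrite (leq_trans _ aTN) // ltn_add2l.
  rewrite big_ord_recr /= dotDl addnS -[k.+1%:R]natr1.
  have := IH (ltnW kT); have := run_descent akN; have := run_regret_step akN uD.
  rewrite dotBr; lra.
have := tel T (leqnn T); have aN := leq_trans (leq_addr T a) aTN.
have := ler_wpM2l (ltW M0) (two _ _ uD (run_v aN)).
have := ler_wpM2l (ltW M0) (two _ _ (run_Delta aN) (run_v aN)).
have := mulr_ge0 (ltW M0) (sqr_ge0 (enorm (u - vs s (a + T)))).
have := mulr_ge0 (ltW M0) (sqr_ge0 (enorm (Deltas s (a + T) - vs s (a + T)))).
lra.
Qed.

(** The constant is [20 = 10 + 8 + 2]: regret, averaging error [T^3 <= 8 m], and midpoint errors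
    [T / 4 <= T^3 / 4 <= 2 m]. *)
Lemma run_episode_grad k T : (1 <= k)%N -> (1 <= T)%N -> (k * T <= N)%N ->
  (T ^ 3 <= 8 * m)%N ->
  T%:R * D * enorm (grad f (ybar T s k))
    <= f (xs s (k.-1 * T)) - f (xs s (k * T)) + 20 * (m%:R * L * D ^+ 3).
Proof.
case: k => // k _ T1 kTN T3 /=; set a := (k * T)%N.
have aT : (k.+1 * T = a + T)%N by rewrite mulSn addnC.
rewrite aT in kTN *.
have T0 : 0 < T%:R :> R by rewrite ltr0n.
have atN (t : 'I_T) : (a + t < N)%N by rewrite (leq_trans _ kTN) // ltn_add2l.
set G := \sum_(t < T) grad f (ys s (a + t).+1).
have ySum : \sum_(t < T) ys s (a + t).+1 = T%:R *: ybar T s k.+1.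
  rewrite /ybar scalerA divff ?gt_eqF // scale1r big_add1 big_mkord.
  by apply: eq_bigr => t _; rewrite addnS.
have yD (t : 'I_T) : enorm (ys s (a + t).+1 - ybar T s k.+1) <= T%:R * D.
  set r := T%:R * D.
  rewrite -(ler_pM2l T0) -{1}(ger0_norm (ltW T0)) -enormZ scalerBr -ySum.
  have -> : T%:R *: ys s (a + t).+1 = \sum_(t' < T) ys s (a + t).+1.
    by rewrite sumr_const card_ord scaler_nat.
  rewrite -sumrB; apply: le_trans (enorm_sum _ _ _) _.
  rewrite mulr_natl -[X in _ *+ X]card_ord -sumr_const; apply: ler_sum => t' _.
  apply: run_y_dist => //; rewrite -addnA ltn_add2l.
    by rewrite (leq_trans (ltn_ord t)) // leq_addl.
  by rewrite (leq_trans (ltn_ord t')) // leq_addl.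
have Gy := grad_average (ltW L0) df HL ySum yD; rewrite -/G in Gy.
have uD : enorm (- (D / enorm G) *: G) <= D.
  have [->|g0] := eqVneq (enorm G) 0.
    by rewrite invr0 mulr0 oppr0 scale0r enorm0 ltW.
  by rewrite enormZ normrN ger0_norm ?divfK // divr_ge0 ?enorm_ge0 // ltW.
have := run_episode kTN uD; rewrite -/G dotZr -sqr_enorm.
(* This survives [G = 0], where both sides are zero. *)
have -> : - (D / enorm G) * enorm G ^+ 2 = - (D * enorm G).
  have [->|g0] := eqVneq (enorm G) 0; first by rewrite expr0n !mulr0 oppr0.
  by field.
have Ty : T%:R * enorm (grad f (ybar T s k.+1))
    <= enorm G + T%:R * (L * (T%:R * D) ^+ 2).
  rewrite -{1}(ger0_norm (ltW T0)) -enormZ.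
  have -> : T%:R *: grad f (ybar T s k.+1)
    = G - (G - T%:R *: grad f (ybar T s k.+1)) by rewrite subKr.
  by apply: le_trans (ler_enormB _ _) _; rewrite lerD2l.
have T3R : T%:R ^+ 3 <= 8 * m%:R :> R by rewrite -natrX -natrM ler_nat.
have T1R : 1 <= T%:R :> R by rewrite ler1n.
have TT3 : T%:R <= T%:R ^+ 3 :> R.
  by rewrite exprS ler_peMr ?exprn_ege1 // ltW.
have LD : 0 < L * D ^+ 3 by rewrite mulr_gt0 // exprn_gt0.
have K1 := ler_wpM2r (ltW LD) T3R.
have K2 := ler_wpM2r (ltW LD) TT3.
have K3 := ler_wpM2r (ltW D0) Ty.
rewrite /M; move: K1 K2 K3; lra.
Qed.

(** The output gradient is no larger than that of any episode average, so the episode bounds add up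
    and the function values telescope. *)
Lemma run_output_grad T yhat : (1 <= T <= N)%N -> (T ^ 3 <= 8 * m)%N ->
  has_lbound (range f) -> nalen_output f N T s yhat ->
  N%:R * D * enorm (grad f yhat)
    <= 2 * (f x0 - inf (range f)) + 2 * (N %/ T)%:R * (20 * (m%:R * L * D ^+ 3)).
Proof.
move=> /andP[T1 TN] T3 lb [_ ymin].
set K := (N %/ T)%N.
have KTN : (K * T <= N)%N by exact: leq_trunc_div.
have tel k : (k <= K)%N -> k%:R * (T%:R * D * enorm (grad f yhat))
    <= f x0 - f (xs s (k * T)) + k%:R * (20 * (m%:R * L * D ^+ 3)).
  elim: k => [_|k IH kK].
    by rewrite !mul0r mul0n; case: run => -> _ _ _; rewrite subrr addr0.
  have kTN : (k.+1 * T <= N)%N by rewrite (leq_trans _ KTN) // leq_mul2r kK orbT.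
  have := run_episode_grad (ltn0Sn k) T1 kTN T3.
  have := IH (ltnW kK).
  have : enorm (grad f yhat) <= enorm (grad f (ybar T s k.+1)).
    by apply: ymin; exists k.+1.
  have TD : 0 < T%:R * D by rewrite mulr_gt0 // ltr0n.
  rewrite -(ler_pM2l TD) -[k.+1%:R]natr1 /=; lra.
have fx : inf (range f) <= f (xs s (K * T)) by apply: ge_inf => //; exists (xs s (K * T)).
(* The incomplete last episode is shorter than [T], and [K >= 1], so the complete ones cover at
   least half of the iterations. *)
have N2 : N%:R <= 2 * (K%:R * T%:R) :> R.
  rewrite -!natrM ler_nat; have := ltn_ceil N T1; rewrite -/K.
  have : (1 <= K)%N by rewrite divn_gt0.
  move=> K1 /ltnW; rewrite mulSn => /leq_trans; apply.
  by rewrite mul2n -addnn leq_add2r leq_pmull.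
have g0 : 0 <= D * enorm (grad f yhat) by rewrite mulr_ge0 ?enorm_ge0 // ltW.
have := ler_wpM2r g0 N2; have := tel K (leqnn K); lra.
Qed.

End Run.

(** * Existence of executions, degenerate radius *)

Section Executions.
Context {R : realType} {d : nat}.
Implicit Types (f : 'rV[R]_d -> R) (s : trace R d).

Lemma last_refreshS (m n : nat) :
  last_refresh m n.+1 = if (m %| n.+1)%N then n.+1 else last_refresh m n.
Proof. by rewrite /last_refresh modnS; case: ifP; rewrite ?subn0 ?subSS. Qed.

(** Compactness of the ball solves both subproblems in every state; a choice function turns the
    solutions into a transition map to iterate. *)
Lemma exists_nalen_run f x0 N m (eta D : R) : 0 <= D ->
  exists s, nalen_run f x0 N m eta D s.
Proof.
move=> D0.
(* A state is (x_n, Delta_n, v_n, z_(pi n)). *)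
pose state := ('rV[R]_d * 'rV[R]_d * 'rV[R]_d * 'rV[R]_d)%type.
pose zof (q : state) := q.1.1.1 + 2^-1 *: q.1.1.2.
pose objD (q : state) w := dot (grad f (zof q)) w
  + 4^-1 * dot ((w - q.1.1.2) *m hess f q.2) (w - q.1.1.2)
  + (2 * eta)^-1 * enorm (w - q.1.2) ^+ 2.
pose objv (q : state) (De w : 'rV[R]_d) :=
  dot (grad f (q.1.1.1 + 2^-1 *: De)) w + (2 * eta)^-1 * enorm (w - q.1.2) ^+ 2.
have stepP (q : state) : exists p : 'rV[R]_d * 'rV[R]_d,
    is_argmin (eball D) (objD q) p.1 /\ is_argmin (eball D) (objv q p.1) p.2.
  have [De DeP] := exists_argmin_eball D0
    (@continuous_quadratic R d (hess f q.2) (grad f (zof q)) q.1.1.2 q.1.2 (2 * eta)^-1).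
  have [v vP] := exists_argmin_eball D0
    (@continuous_quadratic R d 0 (grad f (q.1.1.1 + 2^-1 *: De)) 0 q.1.2 (2 * eta)^-1).
  exists (De, v); split=> //=; rewrite (_ : objv q De = fun w =>
    dot (grad f (q.1.1.1 + 2^-1 *: De)) w + 4^-1 * dot ((w - 0) *m 0) (w - 0)
    + (2 * eta)^-1 * enorm (w - q.1.2) ^+ 2) //.
  by apply/funext => w; rewrite /objv mulmx0 dot0l mulr0 addr0.
have [F FP] := choice stepP.
pose next n (q : state) : state :=
  let x := q.1.1.1 + (F q).1 in
  (x, (F q).1, (F q).2,
   if (m %| n.+1)%N then x + 2^-1 *: (F q).1 else q.2).
pose De0 := - (D / enorm (grad f x0)) *: grad f x0.
pose q0 : state := (x0, De0, De0, x0 + 2^-1 *: De0).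
pose st := fix st n := if n is n'.+1 then next n' (st n') else q0.
pose s := {| xs := fun n => (st n).1.1.1; Deltas := fun n => (st n).1.1.2;
  zs := fun n => zof (st n);
  ys := fun n => (st n.-1).1.1.1 + 2^-1 *: (st n).1.1.2;
  vs := fun n => (st n).1.2 |}.
(* Invariant: the fourth component is the point of the current lazy Hessian. *)
have zr n : (st n).2 = zs s (last_refresh m n).
  elim: n => [|n IH]; first by rewrite /last_refresh mod0n.
  by rewrite last_refreshS; case: ifP => mn; rewrite /= mn.
exists s; split=> // n _; split=> //.
- by have [+ _] := FP (st n); rewrite /objD zr.
- by have [_ +] := FP (st n).
Qed.

Lemma exists_argmin_nat (K : nat) (F : nat -> R) : (0 < K)%N ->
  exists2 k, (1 <= k <= K)%N & forall j, (1 <= j <= K)%N -> F k <= F j.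
Proof.
case: K => // K _; elim: K => [|K [k /andP[k1 kK] kmin]].
  by exists 1%N => // j; rewrite -eqn_leq => /eqP <-.
have [le|lt] := lerP (F k) (F K.+2).
  exists k => [|j /andP[j1]]; first by rewrite k1 leqW.
  by rewrite leq_eqVlt => /orP[/eqP -> //|jK]; rewrite kmin // j1.
exists K.+2 => [|j /andP[j1]]; first by rewrite leqnn.
rewrite leq_eqVlt => /orP[/eqP -> //|jK].
by rewrite (le_trans (ltW lt)) // kmin // j1.
Qed.

Lemma exists_nalen_output f N T s : (0 < N %/ T)%N ->
  exists yhat, nalen_output f N T s yhat.
Proof.
move=> K0.
have [k kK kmin] := exists_argmin_nat (fun k => enorm (grad f (ybar T s k))) K0.
exists (ybar T s k); split; first by exists k.
by move=> _ [j /= jK <-]; exact: kmin.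
Qed.

(* With D = 0 the ball is {0}, so an execution never leaves x0. *)
Lemma nalen_run0_output f x0 N m T (eta : R) s yhat : (0 < T)%N ->
  nalen_run f x0 N m eta 0 s -> nalen_output f N T s yhat -> yhat = x0.
Proof.
move=> T0 [x0E D0E _ run] [[k /= /andP[k1 kK] <-] _].
have b0 (u : 'rV[R]_d) : eball 0 u -> u = 0.
  by move=> u0; apply: enorm_eq0; apply/le_anti; rewrite enorm_ge0 andbT.
have De n : (n < N)%N -> Deltas s n.+1 = 0.
  by move=> /run[_ [/b0 -> _] _ _ _].
have x n : (n <= N)%N -> xs s n = x0.
  elim: n => // n IH nN; have [_ _ -> _ _] := run n nN.
  by rewrite De // addr0 IH // ltnW.
have y n : (n < N)%N -> ys s n.+1 = x0.
  move=> nN; have [_ _ _ -> _] := run n nN.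
  by rewrite De // scaler0 addr0 x // ltnW.
have kT : (k.-1 * T + T <= N)%N.
  rewrite -mulSnr prednK //; apply: leq_trans (leq_trunc_div N T).
  by rewrite leq_mul2r kK orbT.
rewrite /ybar big_add1 big_mkord (eq_bigr (fun=> x0)) => [|t _].
  rewrite sumr_const card_ord -[x0 *+ T]scaler_nat scalerA mulVf ?scale1r //.
  by rewrite pnatr_eq0 -lt0n.
by rewrite addnS y // (leq_trans _ kT) // ltn_add2l.
Qed.

End Executions.

(** * Choice of the parameters *)

Section ParameterChoice.
Context {R : realType}.

Lemma nceil_itv (x : R) : 0 < x -> x <= (nceil x)%:R < x + 1.
Proof.
move=> x0; have c0 : 0 < Num.ceil x by rewrite ceil_gt0.
rewrite /nceil natr_absz gtr0_norm //.
by have /andP[] := ceil_itv x; rewrite rmorphB /= ltrBlDr => -> ->.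
Qed.

Lemma powR_third (r : R) : 0 < r ->
  [/\ 0 < r `^ (1 / 3), (r `^ (1 / 3)) ^+ 3 = r
    & r `^ (2 / 3) = (r `^ (1 / 3)) ^+ 2].
Proof.
move=> r0; have p0 := powR_gt0 (1 / 3) r0; split=> //.
- rewrite -powR_mulrn ?ltW // -powRrM.
  by rewrite (_ : 1 / 3 * 3 = 1) ?powRr1 ?ltW //; field.
- by rewrite -powR_mulrn ?(ltW p0) // -powRrM; congr (_ `^ _); field.
Qed.

Lemma powR_half (r : R) : 0 < r ->
  [/\ 0 < r `^ (1 / 2), (r `^ (1 / 2)) ^+ 2 = r
    & r `^ (- (3 / 2)) = ((r `^ (1 / 2)) ^+ 3)^-1].
Proof.
move=> r0; have p0 := powR_gt0 (1 / 2) r0; split=> //.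
- rewrite -powR_mulrn ?ltW // -powRrM.
  by rewrite (_ : 1 / 2 * 2 = 1) ?powRr1 ?ltW //; field.
- by rewrite powRN -powR_mulrn ?(ltW p0) // -powRrM; congr (_ `^ _)^-1; field.
Qed.

(* q, l, e stand for m^(1/3), L^(1/2), eps^(1/2). *)
Lemma finds_stationary (d : nat) (f : 'rV[R]_d -> R) (L eps : R) x0
    (q l e D : R) (N m T : nat) :
  0 < L -> twice_differentiable f -> hess_lipschitz L f ->
  has_lbound (range f) ->
  0 < q -> q ^+ 3 = m%:R -> (1 <= m)%N ->
  0 < l -> l ^+ 2 = L -> 0 < e -> e ^+ 2 = eps ->
  let F0 := f x0 - inf (range f) in
  343 * (m%:R + q * F0 * l / e ^+ 3) <= N%:R -> q <= T%:R <= 2 * q ->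
  0 <= D -> D ^+ 3 * (N%:R * L * q ^+ 2) = F0 ->
  nalen_finds_stationary f x0 N m T (4^-1 * (1 / (m%:R * L * D))) D eps.
Proof.
move=> L0 df HL lb q0 q3 m1 l0 l2 e0 e2 F0 NE /andP[qT Tq] D0 D3.
have F00 : 0 <= F0 by rewrite subr_ge0; apply: ge_inf => //; exists x0.
have m1R : 1 <= m%:R :> R by rewrite ler1n.
have A0 : 0 <= q * F0 * l / e ^+ 3.
  by rewrite divr_ge0 ?exprn_ge0 // ?mulr_ge0 // ltW.
have q1 : 1 <= q.
  by rewrite -(@ler_pXn2r _ 3) ?nnegrE ?(ltW q0) // expr1n q3.
have qm : q <= m%:R by rewrite -q3 exprS ler_peMr ?exprn_ege1 // ltW.
have NR : 343 * m%:R <= N%:R :> R by lra.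
have T1 : (1 <= T)%N by rewrite -(ltr0n R) (lt_le_trans q0).
have TN : (T <= N)%N by rewrite -(ler_nat R); lra.
have K0 : (0 < N %/ T)%N by rewrite divn_gt0.
split.
  have [s run] := exists_nalen_run f x0 N m (4^-1 * (1 / (m%:R * L * D))) D0.
  by have [y out] := exists_nalen_output f s K0; exists s, y.
move=> s yhat run out; have eps0 : 0 < eps by rewrite -e2 exprn_gt0.
(* A zero radius forces [F0 = 0]: then [x0] is a global minimizer and the run returns it. *)
have [D00|Dn0] := eqVneq D 0.
  move: run; rewrite D00 => run; rewrite (nalen_run0_output T1 run out).
  have F0E : F0 = 0 by rewrite -D3 D00 expr0n mul0r.
  rewrite (grad_eq0_at_min df) ?enorm0 ?ltW // => y.
  have -> : f x0 = inf (range f) by move: F0E; rewrite /F0; lra.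
  by apply: ge_inf => //; exists y.
have Dp : 0 < D by rewrite lt_neqAle eq_sym Dn0.
have T3 : (T ^ 3 <= 8 * m)%N.
  rewrite -(ler_nat R) natrX natrM -q3.
  have -> : 8 * q ^+ 3 = (2 * q) ^+ 3 by ring.
  by rewrite lerXn2r ?nnegrE //; lra.
have TN' : (1 <= T <= N)%N by rewrite T1.
have := run_output_grad L0 df HL Dp m1 erefl run TN' T3 lb out.
rewrite -/F0 -D3; set g := enorm _; set K := (N %/ T)%N => H.
have N0 : 0 < N%:R :> R by lra.
(* Writes [m] as [q * q ^+ 2] and uses [K q <= K T <= N]. *)
have Km : K%:R * m%:R <= N%:R * q ^+ 2.
  rewrite -q3 exprS mulrA ler_wpM2r ?exprn_ge0 ?(ltW q0) //.
  apply: le_trans (_ : K%:R * T%:R <= _); first by rewrite ler_wpM2l.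
  by rewrite -natrM ler_nat leq_trunc_div.
(* [42 = 2 + 40]: the gap [F0], expressed through [D ^+ 3], and the episode errors. *)
have gle : g <= 42 * q ^+ 2 * L * D ^+ 2.
  have LD : 0 <= L * D ^+ 3 by rewrite mulr_ge0 ?exprn_ge0 // ltW.
  have ND : 0 < N%:R * D by rewrite mulr_gt0.
  by rewrite -(ler_pM2l ND); have := ler_wpM2r LD Km; lra.
have F0p : 0 < F0.
  by rewrite -D3 !(mulr_gt0, exprn_gt0).
have e3 : 0 < e ^+ 3 by rewrite exprn_gt0.
have D7 : 0 <= D * (7 * q * l) by rewrite !mulr_ge0 // ltW.
(* Cubed, this is the lower bound on [N] with [343 = 7 ^ 3]; squared, it gives
   [49 q^2 L D^2 <= eps], which exceeds the required 42. *)
have De : D * (7 * q * l) <= e.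
  rewrite -(@ler_pXn2r _ 3) ?nnegrE ?(ltW e0) //.
  rewrite -(ler_pM2l F0p).
  have : 343 * (q * F0 * l / e ^+ 3) <= N%:R by lra.
  rewrite mulrA ler_pdivrMr // => Ne.
  have w : 0 < D ^+ 3 * (l ^+ 2 * q ^+ 2) by rewrite !(mulr_gt0, exprn_gt0).
  have := ler_wpM2l (ltW w) Ne.
  have : F0 * e ^+ 3 = D ^+ 3 * (N%:R * L * q ^+ 2) * e ^+ 3 by rewrite D3.
  rewrite -l2; lra.
apply: le_trans gle _; rewrite -e2 -l2.
have : (D * (7 * q * l)) ^+ 2 <= e ^+ 2.
  by rewrite lerXn2r ?nnegrE ?(ltW e0).
have : 0 <= q ^+ 2 * l ^+ 2 * D ^+ 2 by rewrite !mulr_ge0 // ltW.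
lra.
Qed.

End ParameterChoice.

(** * Oracle complexity *)

Section Complexity.
Context {R : realType} {d : nat}.
Implicit Types (s : trace R d).

(** The two inequalities characterize the count as the ceiling of [N / m]. *)
Lemma count_dvdn (m N : nat) : (0 < m)%N ->
  (N <= m * count (dvdn m) (iota 0 N) < N + m)%N.
Proof.
move=> m0; elim: N => [|N]; first by rewrite muln0.
have -> : iota 0 N.+1 = iota 0 N ++ [:: N] by rewrite -addn1 iotaD.
rewrite count_cat /= addn0; set c := count _ _.
have [/dvdnP[k ->]|mN] := boolP (m %| N)%N; rewrite /= => /andP[Nc cN].
  have ck : c = k.
    move: Nc cN; rewrite -mulSnr (mulnC m) leq_pmul2r // ltn_pmul2r // ltnS.
    by move=> kc ck; apply/eqP; rewrite eqn_leq ck.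
  rewrite ck mulnDr muln1 (mulnC m) addSn ltnS leqnn andbT.
  by rewrite -addn1 leq_add2l.
rewrite addn0 addSn (ltn_trans cN) // andbT ltn_neqAle Nc andbT.
by apply: contraNneq mN => ->; exact: dvdn_mulr.
Qed.

Lemma hess_queries_bounds (N m : nat) s : (0 < m)%N ->
  (N <= m * size (hess_queries N m s) < N + m)%N.
Proof.
move=> m0; rewrite /hess_queries size_map size_filter.
exact: count_dvdn.
Qed.

Lemma grad_queries_bounds (N T : nat) s :
  (N <= size (grad_queries N T s) <= 3 * N + 1)%N.
Proof.
rewrite /grad_queries /= !size_cat !size_map !size_iota.
rewrite leqW ?leq_addr //= addn1 ltnS !mulSn mul0n addn0 !leq_add2l.
exact: leq_div.
Qed.

Lemma oracle_costE (cH cg : R) (N m T : nat) s : 0 < cg ->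
  oracle_cost cH cg N m T s = cg * equiv_grad_complexity (cH / cg) N m T s.
Proof.
move=> cg0; rewrite /oracle_cost /equiv_grad_complexity mulrDr; congr (_ + _).
by rewrite mulrA mulrCA divff ?mulr1 // gt_eqF.
Qed.

(** Hessians cost at most [m h <= N + m <= 2 N], gradients at most [3 N + 1 <= 4 N]. *)
Lemma equiv_grad_complexity_upper (dbar : R) (N m T : nat) s :
  (0 < m)%N -> 0 <= dbar <= m%:R -> (m <= N)%N ->
  equiv_grad_complexity dbar N m T s <= 6 * N%:R.
Proof.
move=> m0 /andP[d0 dm] mN; rewrite /equiv_grad_complexity.
have /andP[_] := hess_queries_bounds N s m0.
have /andP[_] := grad_queries_bounds N T s.
set h := size (hess_queries _ _ _); set g := size _.
rewrite -(ler_nat R) natrD natrM => gN /ltnW.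
rewrite -(ler_nat R) natrD natrM => hN.
have m1 : 1 <= m%:R :> R by rewrite ler1n.
have mNR : m%:R <= N%:R :> R by rewrite ler_nat.
have := ler_wpM2r (ler0n R h) dm; lra.
Qed.

(** No period beats the order of [dbar + b * A]. If [b <= p], the gradient calls alone exceed
    [p * A >= b * A]. Otherwise refreshes are frequent: [m h >= p * A] gives
    [A <= p ^+ 2 * h <= b ^+ 2 * h], so the Hessian cost dominates [b * A]. At least one Hessian
    call pays for [dbar]. *)
Lemma equiv_grad_complexity_lower (dbar A b p : R) (N m T : nat) s :
  (0 < m)%N -> 0 < b -> b ^+ 3 = dbar -> 0 < p -> p ^+ 3 = m%:R -> 0 <= A ->
  m%:R + p * A <= N%:R ->
  dbar + b * A <= 2 * equiv_grad_complexity dbar N m T s.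
Proof.
move=> m0 b0 <- p0 pm A0 NA; rewrite /equiv_grad_complexity.
have /andP[] := hess_queries_bounds N s m0.
have /andP[] := grad_queries_bounds N T s.
set h := size (hess_queries _ _ _); set g := size _.
rewrite -(ler_nat R) => gN _; rewrite -(ler_nat R) natrM => hN _.
have pA : 0 <= p * A by rewrite mulr_ge0 // ltW.
have p3 : 0 < p ^+ 3 by rewrite exprn_gt0.
have h1 : 1 <= h%:R :> R.
  rewrite ler1n lt0n; apply/eqP => h0; move: hN; rewrite h0 mulr0; lra.
have b3 : 0 < b ^+ 3 by rewrite exprn_gt0.
have bh := ler_wpM2l (ltW b3) h1.
have g0 : 0 <= g%:R :> R by rewrite ler0n.
have [bp|pb] := lerP b p.
  have := ler_wpM2r A0 bp; lra.
have Ah : A <= p ^+ 2 * h%:R.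
  rewrite -(ler_pM2l p0); move: hN; rewrite -pm; lra.
have pb2 : p ^+ 2 <= b ^+ 2 by rewrite lerXn2r ?nnegrE ?(ltW pb) ?(ltW b0) ?(ltW p0).
have : b * A <= b * (b ^+ 2 * h%:R).
  rewrite ler_pM2l // (le_trans Ah) // ler_wpM2r //; lra.
lra.
Qed.

End Complexity.

Theorem theorem4p1 (R : realType) :
  exists ceta cT cD cN cm C : R,
    [&& 0 < ceta, 0 < cT, 0 < cD, 0 < cN, 0 < cm & 0 < C] /\
  forall (d : nat) (f : 'rV[R]_d -> R) (L : R) (x0 : 'rV[R]_d) (eps : R),
    0 < L ->
    twice_differentiable f ->
    hess_lipschitz L f ->
    has_lbound (range f) ->
    0 < eps ->
  let F0 : R := f x0 - inf (range f) in
  let E (r : R) : R :=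
    r + r `^ (1 / 3) * F0 * L `^ (1 / 2) * eps `^ (- (3 / 2)) in
  let N (m : nat) : nat := nceil (cN * E m%:R) in
  let T (m : nat) : nat := nceil (cT * m%:R `^ (1 / 3)) in
  let D (m : nat) : R :=
    cD * (F0 / ((N m)%:R * L * m%:R `^ (2 / 3))) `^ (1 / 3) in
  let eta (m : nat) : R := ceta * (1 / (m%:R * L * D m)) in
  (forall m : nat, (1 <= m)%N ->
     (N m)%:R <= C * E m%:R /\
     nalen_finds_stationary f x0 (N m) m (T m) (eta m) (D m) eps) /\
  (forall cH cg : R, 0 < cH -> 0 < cg ->
     let dbar : R := cH / cg in
     1 <= dbar <= d%:R ->
     let m : nat := nceil (cm * dbar) in
     nalen_finds_stationary f x0 (N m) m (T m) (eta m) (D m) eps /\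
     forall s : trace R d, nalen_run f x0 (N m) m (eta m) (D m) s ->
       equiv_grad_complexity dbar (N m) m (T m) s <= C * E dbar /\
       (forall (m' : nat) (s' : trace R d), (1 <= m')%N ->
          nalen_run f x0 (N m') m' (eta m') (D m') s' ->
          oracle_cost cH cg (N m) m (T m) s
            <= C * oracle_cost cH cg (N m') m' (T m') s')).
Proof.
(* [343 = 7 ^ 3] comes from the bound on [D]; [8256 = 2 * 4128] combines the upper cost bound with
   the factor 2 of the lower one. *)
exists 4^-1, 1, 1, 343, 1, 8256; split.
  by rewrite invr_gt0 !ltr0n ltr01.
move=> d f L x0 eps L0 df HL lb eps0 F0 E N T D eta.
have [l0 l2 _] := powR_half L0; have [e0 e2 e3] := powR_half eps0.
have F00 : 0 <= F0 by rewrite subr_ge0; apply: ge_inf => //; exists x0.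
pose A := F0 * L `^ (1 / 2) * eps `^ (- (3 / 2)).
have A0 : 0 <= A by rewrite !mulr_ge0 ?powR_ge0.
have EA r : E r = r + r `^ (1 / 3) * A by rewrite /E /A !mulrA.
have Emin m : (1 <= m)%N -> m%:R <= E m%:R.
  by move=> m1; rewrite EA lerDl mulr_ge0 ?powR_ge0.
have Nitv m : (1 <= m)%N -> 343 * E m%:R <= (N m)%:R < 343 * E m%:R + 1.
  move=> m1; apply: nceil_itv; have := Emin m m1.
  have : 1 <= m%:R :> R by rewrite ler1n.
  lra.
have NE m : (1 <= m)%N -> (N m)%:R <= 344 * E m%:R.
  move=> m1; have /andP[_] := Nitv m m1; have := Emin m m1.
  have : 1 <= m%:R :> R by rewrite ler1n.
  lra.
have finds m : (1 <= m)%N ->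
    nalen_finds_stationary f x0 (N m) m (T m) (eta m) (D m) eps.
  move=> m1; have m0 : 0 < m%:R :> R by rewrite ltr0n.
  have [q0 q3 q2] := powR_third m0.
  have /andP[NE1 _] := Nitv m m1.
  have N0 : 0 < (N m)%:R :> R.
    by have := Emin m m1; lra.
  have q1 : 1 <= m%:R `^ (1 / 3) :> R.
    by rewrite -(@ler_pXn2r _ 3) ?nnegrE ?(ltW q0) // q3 expr1n ler1n.
  apply: (finds_stationary L0 df HL lb q0 q3 m1 l0 l2 e0 e2).
  - by rewrite -e3; move: NE1; rewrite EA /A !mulrA.
  - have := @nceil_itv R (1 * m%:R `^ (1 / 3)); rewrite -/(T m) mul1r => /(_ q0).
    by move=> /andP[-> /ltW /le_trans -> //]; lra.
  - by rewrite /D mul1r powR_ge0.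
  - rewrite /D mul1r q2; set w := _ * _ * _.
    have w0 : 0 < w by rewrite !mulr_gt0 ?exprn_gt0.
    (* A zero gap makes the cube root, hence [D m], zero, so both sides vanish. *)
    have [F0z|F0n] := eqVneq F0 0.
      by rewrite F0z mul0r powR0 ?expr0n ?mul0r // gt_eqF // divr_gt0.
    have F0p : 0 < F0 by rewrite lt_neqAle eq_sym F0n.
    have [_ -> _] := powR_third (divr_gt0 F0p w0).
    by rewrite divfK // gt_eqF.
split=> [m m1|cH cg cH0 cg0 dbar /andP[dbar1 _] m].
  split; last exact: finds.
  have := NE m m1; have := Emin m m1; have := ler0n R m; lra.
have dbar0 : 0 < dbar by lra.
have /andP[dm md] : dbar <= m%:R < dbar + 1 by rewrite /m mul1r; exact: nceil_itv.
have m0 : 0 < m%:R :> R by lra.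
have m1 : (1 <= m)%N by rewrite -(ltr0n R).
split=> [|s _]; first exact: finds.
have [b0 b3 _] := powR_third dbar0; have [a0 a3 _] := powR_third m0.
(* Rounding gives [m < dbar + 1 <= 2 * dbar], well below the [8 * dbar] needed after cubing. *)
have ab : m%:R `^ (1 / 3) <= 2 * dbar `^ (1 / 3).
  have b20 : 0 <= 2 * dbar `^ (1 / 3) by rewrite mulr_ge0 // ltW.
  by rewrite -(@ler_pXn2r _ 3) ?nnegrE ?(ltW a0) // a3 exprMn b3; lra.
have Em : E m%:R <= 2 * E dbar.
  by have := ler_wpM2r A0 ab; rewrite !EA; lra.
have mN : (m <= N m)%N.
  have /andP[NE1 _] := Nitv m m1; have := Emin m m1.
  by rewrite -(ler_nat R); lra.
(* [4128 = 6 * 344 * 2]: cost per iteration, [N] against [E m] with rounding included, and [E m]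
   against [E dbar]. *)
have up : equiv_grad_complexity dbar (N m) m (T m) s <= 4128 * E dbar.
  have dm0 : 0 <= dbar <= m%:R by rewrite dm andbT ltW.
  have := equiv_grad_complexity_upper (T m) s m1 dm0 mN.
  have := NE m m1; lra.
have Ed : 0 <= E dbar by rewrite EA addr_ge0 ?(ltW dbar0) // mulr_ge0 // ltW.
split=> [|m' s' m'1 _]; first by lra.
rewrite !oracle_costE // mulrCA ler_pM2l //.
have m'0 : 0 < m'%:R :> R by rewrite ltr0n.
have [p0 p3 _] := powR_third m'0.
have NA' : m'%:R + m'%:R `^ (1 / 3) * A <= (N m')%:R.
  rewrite -EA; have /andP[NE1 _] := Nitv m' m'1; apply: le_trans NE1.
  by rewrite ler_peMl ?ler1n // (le_trans _ (Emin m' m'1)).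
have := equiv_grad_complexity_lower (T m') s' m'1 b0 b3 p0 p3 A0 NA'.
rewrite -EA -/dbar; move: up.
move: (E dbar) (equiv_grad_complexity _ _ _ _ s) (equiv_grad_complexity _ _ _ _ s').
by clear=> x y z; lra.
Qed.
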